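(* Let $S$ be an $AG^{*}$ groupoid and let $\Pi$ be any permutation of the set $\{1,2,3\}$. Then the ternary operation on $S$ defined by $[a_1a_2a_3]_\Pi=(a_{\Pi(1)}a_{\Pi(2)})a_{\Pi(3)}$ is a semiheap and satisfies the generalised heap axioms.
   Context: A groupoid is a set with a binary operation, written as juxtaposition. An $AG^{*}$ groupoid is a groupoid that is right modular, $(xy)z=(zy)x$, and weakly associative, $(xy)z=y(xz)$, for all $x,y,z$. A ternary operation $[\ ]$ is a semiheap if $[[xyz]uv]=[x[uzy]v]=[xy[zuv]]$ for all $x,y,z,u,v$. The generalised heap axioms are the two identities $[xx[yyz]]=[yy[xxz]]$ and $[[xyy]zz]=[[xzz]yy]$ (idempotency is not included). *)

(* Defs.v *)
From mathcomp Require Import all_boot all_fingroup.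

Set Implicit Arguments.
Unset Strict Implicit.
Unset Printing Implicit Defensive.

Local Open Scope group_scope.

Definition right_modular (S : magmaType) : Prop :=
  forall x y z : S, (x * y) * z = (z * y) * x.

Definition weakly_associative (S : magmaType) : Prop :=
  forall x y z : S, (x * y) * z = y * (x * z).

Definition AGstar_groupoid (S : magmaType) : Prop :=
  right_modular S /\ weakly_associative S.

Section Ternary.

Variables (T : Type) (t : T -> T -> T -> T).

Definition semiheap : Prop :=
  forall x y z u v : T,
    t (t x y z) u v = t x (t u z y) v /\
    t x (t u z y) v = t x y (t z u v).

Definition generalised_heap_axioms : Prop :=
  (forall x y z : T, t x x (t y y z) = t y y (t x x z)) /\
  (forall x y z : T, t (t x y y) z z = t (t x z z) y y).

End Ternary.

(* The indices 1, 2, 3 are represented by the elements 0, 1, 2 of 'I_3. *)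
Definition perm_op (S : magmaType) (Pi : 'S_3) (a1 a2 a3 : S) : S :=
  let a := tnth [tuple a1; a2; a3] in
  (a (Pi (@Ordinal 3 0 isT)) * a (Pi (@Ordinal 3 1 isT)))
    * a (Pi (@Ordinal 3 2 isT)).

(* Main.v *)
(** In an AG* groupoid, every product of four factors is independent of both
    the bracketing and the order of the factors, and the same then holds for
    products of five factors. Both sides of each semiheap and generalised heap
    identity are products of the same five factors. *)
Require Import Defs.
From mathcomp Require Import all_boot all_fingroup.

Local Open Scope group_scope.

Section AGstar.

Variables (S : magmaType) (hS : AGstar_groupoid S).
Implicit Types a b c d e x y z u v : S.

Let rmod : right_modular S := proj1 hS.
Let wass : weakly_associative S := proj2 hS.

(** Weak associativity rewrites [a * (b * c)] as [(b * a) * c], whose outer factors right modularity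
    exchanges. *)
Lemma mul_swap23 a b c : a * (b * c) = a * (c * b).
Proof. by rewrite -!wass rmod. Qed.

(** The medial law: right modularity at the root, inside, and at the root again. *)
Lemma mulACA a b c d : (a * b) * (c * d) = (a * c) * (b * d).
Proof. by rewrite rmod (rmod c) -rmod. Qed.

Lemma mul22_swap13 a b c d : (a * b) * (c * d) = (c * b) * (a * d).
Proof. by rewrite rmod [c * d * b]wass wass mul_swap23. Qed.

(** The transposition (1 2) is the conjugate of (2 3) by (1 3). *)
Lemma mul22_swap12 a b c d : (a * b) * (c * d) = (b * a) * (c * d).
Proof. by rewrite mul22_swap13 mulACA mul22_swap13. Qed.

(** Right modularity yields [(d * c) * (a * b)]; swaps within the two-by-two bracketing then restore
    the order. *)
Lemma mul4_22E a b c d : ((a * b) * c) * d = (a * b) * (c * d).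
Proof.
by rewrite rmod mul22_swap13 [LHS]mulACA [LHS]mul_swap23 [LHS]mulACA mul_swap23.
Qed.

Lemma mul13_1E a b c d : (a * (b * c)) * d = ((a * b) * c) * d.
Proof. by rewrite wass mul4_22E mulACA mul22_swap12. Qed.

Lemma mul4_swap12 a b c d : ((a * b) * c) * d = ((b * a) * c) * d.
Proof. by rewrite !mul4_22E mul22_swap12. Qed.

Lemma mul4_swap23 a b c d : ((a * b) * c) * d = ((a * c) * b) * d.
Proof. by rewrite !mul4_22E mulACA. Qed.

Lemma mul4_swap34 a b c d : ((a * b) * c) * d = ((a * b) * d) * c.
Proof. by rewrite !mul4_22E mul_swap23. Qed.

Lemma mul5_front a :
  ((forall b c d e, (b * a * c * d * e = a * b * c * d * e)%g)
  * (forall b c d e, (b * c * a * d * e = a * b * c * d * e)%g)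
  * (forall b c d e, (b * c * d * a * e = a * b * c * d * e)%g)
  * (forall b c d e, (b * c * d * e * a = a * b * c * d * e)%g))%type.
Proof.
have front2 b c d e : b * a * c * d * e = a * b * c * d * e.
  by rewrite (mul4_swap12 b).
have front3 b c d e : b * c * a * d * e = a * b * c * d * e.
  by rewrite (mul4_swap23 b c) front2.
have front4 b c d e : b * c * d * a * e = a * b * c * d * e.
  by rewrite (mul4_swap34 b c) front3.
(* Taking [b * c] as a single factor lets the four-factor swap reach the fifth place. *)
have front5 b c d e : b * c * d * e * a = a * b * c * d * e.
  by rewrite (mul4_swap34 (b * c) d) front4.
by [].
Qed.

Lemma mul5_second a b :
  ((forall c d e, (a * c * b * d * e = a * b * c * d * e)%g)
  * (forall c d e, (a * c * d * b * e = a * b * c * d * e)%g)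
  * (forall c d e, (a * c * d * e * b = a * b * c * d * e)%g))%type.
Proof.
by do ![split] => c d e; rewrite (mul5_front b) (mul4_swap12 b).
Qed.

Lemma mul5_third a b c :
  ((forall d e, (a * b * d * c * e = a * b * c * d * e)%g)
  * (forall d e, (a * b * d * e * c = a * b * c * d * e)%g))%type.
Proof.
by split=> d e; rewrite (mul5_second a c) (mul4_swap23 a c).
Qed.

(** Both rules are oriented towards left-nested products, the normal form used below. *)
Let flatten := (mul13_1E, fun a b c d => esym (mul4_22E a b c d)).

Lemma perm_op_nestedE (Pi : 'S_3) x y z u v :
  [/\ perm_op Pi (perm_op Pi x y z) u v = x * y * z * u * v,
      perm_op Pi x (perm_op Pi y z u) v = x * y * z * u * v
    & perm_op Pi x y (perm_op Pi z u v) = x * y * z * u * v].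
Proof.
(* Injectivity of [Pi] in computable form: of the 27 triples of values, only the six permutations
   survive. *)
have : uniq [seq Pi i | i <- [:: @Ordinal 3 0 isT; @Ordinal 3 1 isT;
                                @Ordinal 3 2 isT]].
  by rewrite map_inj_uniq //; apply: perm_inj.
rewrite /perm_op /tnth /= !inE -!val_eqE.
case: (Pi (@Ordinal 3 0 isT)) => [[|[|[|//]]] ?];
case: (Pi (@Ordinal 3 1 isT)) => [[|[|[|//]]] ?] //;
case: (Pi (@Ordinal 3 2 isT)) => [[|[|[|//]]] ?] // _ /=.
all: split; rewrite ?flatten ?(mul5_front x) ?(mul5_second x y)
  ?(mul5_third x y z) //.
(* Once [x], [y], [z] are in place, only [u] and [v] can be out of order. *)
all: exact: mul4_swap34.
Qed.

End AGstar.

Theorem theorem38 (S : magmaType) (hS : AGstar_groupoid S) (Pi : 'S_3) :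
  semiheap (perm_op Pi : S -> S -> S -> S) /\
  generalised_heap_axioms (perm_op Pi : S -> S -> S -> S).
Proof.
pose nestedE := perm_op_nestedE S hS Pi.
split=> [x y z u v|].
  have [-> _ ->] := nestedE x y z u v; have [_ -> _] := nestedE x u z y v.
  (* The middle form has become [x * u * z * y * v], with the inner triple reversed. *)
  by rewrite (mul5_second _ hS x y) (mul4_swap34 _ hS x y).
split=> x y z.
  have [_ _ ->] := nestedE x x y y z; have [_ _ ->] := nestedE y y x x z.
  by rewrite !(mul5_front _ hS y).
have [-> _ _] := nestedE x y y z z; have [-> _ _] := nestedE x z z y y.
by rewrite !(mul5_second _ hS x z).
Qed.
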